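(* There is a unique function $G\mapsto H(G,s)\in\mathbb{Z}[s]$ on nonempty finite graphs satisfying (1) $H(G)=H(G-e)+H(G/e)-H(G-u)-H(G-v)$ for every edge $e$ of $G$ with distinct endpoints $u\neq v$; (2) $H(G_1+G_2)=H(G_1)H(G_2)$ for disjoint unions of nonempty graphs; (3) $H(K_1^n)=ns$ for all $n\geq 0$; and for every graph $G$ and every $k$, the coefficient of $s^k$ in $H(G,s)$ equals $h_k(G)$, the number of $k$-components Hamiltonian cycles of $G$.
   Context: Graphs are finite triples $G=(V,E,\varphi)$ with loops and multiple edges allowed, $\varphi$ mapping each edge to an unordered pair of (possibly equal) vertices. Degrees count loops twice. $G_1+G_2$ denotes the disjoint union. A $k$-components Hamiltonian cycle of $G$ is a spanning subgraph of $G$ with exactly $k$ connected components in which every vertex has degree $2$; these are counted as subgraphs. $K_1^n$ is the graph with one vertex and $n$ loops. For an edge $e$ with endpoints $u\neq v$: $G-e$ deletes $e$; $G/e$ deletes $e$ and identifies $u$ and $v$ (other edges between $u$ and $v$ become loops); $G-u$ deletes $u$ and all edges incident with it. *)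

(* Defs.v *)
From mathcomp Require Import all_boot all_order all_algebra.

Set Implicit Arguments.
Unset Strict Implicit.
Unset Printing Implicit Defensive.

Import GRing.Theory.

(* An unordered pair of possibly equal vertices is a set with one element
   (the ends of a loop) or two elements. *)
Record mgraph : Type := MGraph {
  vertex : finType;
  edge : finType;
  ends : edge -> {set vertex};
  endsP : forall e, 0 < #|ends e| <= 2
}.

Definition degree (G : mgraph) (x : vertex G) : nat :=
  #|[set e : edge G | x \in ends e]| + #|[set e : edge G | ends e == [set x]]|.

Definition adjacent (G : mgraph) : rel (vertex G) :=
  [rel x y | [exists e : edge G, (x \in ends e) && (y \in ends e)]].

Definition components (G : mgraph) : nat := n_comp (@adjacent G) predT.

Definition isomorphic (G1 G2 : mgraph) : Prop :=
  exists (f : vertex G1 -> vertex G2) (g : edge G1 -> edge G2),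
    [/\ bijective f, bijective g & forall e, ends (g e) = f @: ends e].

Section Constructions.

Variable G : mgraph.

Definition spanning_subgraph (F : {set edge G}) : mgraph :=
  @MGraph (vertex G) {e : edge G | e \in F} (fun e => ends (val e))
    (fun e => endsP (val e)).

Definition del_edge (e : edge G) : mgraph := spanning_subgraph [set~ e].

(* The vertices of G/e are the classes of the equivalence relation on the
   vertices of G that identifies the ends of e and nothing else. *)
Definition merge_class (e : edge G) (x : vertex G) : {set vertex G} :=
  if x \in ends e then ends e else [set x].

Definition merged (e : edge G) : finType :=
  {A : {set vertex G} | A \in codom (merge_class e)}.

Definition merge (e : edge G) (x : vertex G) : merged e :=
  exist _ (merge_class e x) (codom_f (merge_class e) x).

Lemma contract_endsP (e : edge G) (f : {f : edge G | f != e}) :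
  0 < #|[set merge e x | x in ends (val f)]| <= 2.
Proof.
have /andP[f0 f2] := endsP (val f).
rewrite (leq_trans (leq_imset_card _ _) f2) andbT.
have [x xf] := card_gt0P f0.
by apply/card_gt0P; exists (merge e x); apply: imset_f.
Qed.

Definition contract (e : edge G) : mgraph :=
  @MGraph (merged e) {f : edge G | f != e}
    (fun f => [set merge e x | x in ends (val f)]) (@contract_endsP e).

Lemma del_vertex_endsP (u : vertex G) (e : {e : edge G | u \notin ends e}) :
  0 < #|[set x : {x : vertex G | x != u} | val x \in ends (val e)]| <= 2.
Proof.
case: e => e /= ue; have /andP[e0 e2] := endsP e.
set A := [set _ | _].
have -> : #|A| = #|ends e|.
  rewrite -(card_imset _ val_inj); apply: eq_card => x.
  apply/imsetP/idP => [[y]|xe]; first by rewrite inE => ? ->.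
  have xu : x != u by apply: contraNneq ue => <-.
  by exists (exist _ x xu); rewrite ?inE.
by rewrite e0.
Qed.

Definition del_vertex (u : vertex G) : mgraph :=
  @MGraph {x : vertex G | x != u} {e : edge G | u \notin ends e}
    (fun e => [set x | val x \in ends (val e)]) (@del_vertex_endsP u).

End Constructions.

Lemma disjoint_union_endsP (G1 G2 : mgraph) (e : edge G1 + edge G2) :
  0 < #|match e return {set vertex G1 + vertex G2} with
        | inl e1 => inl @: ends e1
        | inr e2 => inr @: ends e2
        end| <= 2.
Proof.
by case: e => e; rewrite card_imset ?endsP // => x y [].
Qed.

Definition disjoint_union (G1 G2 : mgraph) : mgraph :=
  MGraph (@disjoint_union_endsP G1 G2).

Lemma bouquet_endsP (n : nat) (e : 'I_n) : 0 < #|[set tt]| <= 2.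
Proof. by rewrite cards1. Qed.

(* K_1^n *)
Definition bouquet (n : nat) : mgraph := MGraph (@bouquet_endsP n).

Definition is_ham_cycle (k : nat) (G : mgraph) (F : {set edge G}) : bool :=
  [forall x : vertex (spanning_subgraph F), degree x == 2]
  && (components (spanning_subgraph F) == k).

(* A spanning subgraph of G is determined by its edge set. *)
Definition ham_count (k : nat) (G : mgraph) : nat :=
  #|[set F : {set edge G} | is_ham_cycle k F]|.

Record ngraph : Type := NGraph {
  ngraph_mgraph :> mgraph;
  ngraphP : 0 < #|vertex ngraph_mgraph|
}.

Lemma contract_nonempty (G : ngraph) (e : edge G) : 0 < #|vertex (contract e)|.
Proof.
by have [x _] := card_gt0P (ngraphP G); apply/card_gt0P; exists (merge e x).
Qed.

Lemma del_vertex_nonempty (G : mgraph) (u v : vertex G) :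
  v != u -> 0 < #|vertex (del_vertex u)|.
Proof. by move=> vu; apply/card_gt0P; exists (exist _ v vu). Qed.

Definition ndel_edge (G : ngraph) (e : edge G) : ngraph :=
  @NGraph (del_edge e) (ngraphP G).

Definition ncontract (G : ngraph) (e : edge G) : ngraph :=
  NGraph (contract_nonempty e).

(* The witness v only serves to show that G - u is nonempty. *)
Definition ndel_vertex (G : ngraph) (u v : vertex G) (vu : v != u) : ngraph :=
  NGraph (del_vertex_nonempty vu).

Local Open Scope ring_scope.

(* [vu] and [uv] are the same condition; both are bound because [ndel_vertex]
   takes one of them for each of G - u and G - v. *)
Definition deletion_contraction (H : ngraph -> {poly int}) : Prop :=
  forall (G : ngraph) (e : edge G) (u v : vertex G)
    (vu : v != u) (uv : u != v),
    ends e = [set u; v] ->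
    H G = H (ndel_edge e) + H (ncontract e)
          - H (ndel_vertex vu) - H (ndel_vertex uv).

(* G1 + G2 and K_1^n are only determined up to isomorphism, so the next two
   conditions are imposed on all graphs of the given shape. *)
Definition multiplicative (H : ngraph -> {poly int}) : Prop :=
  forall G G1 G2 : ngraph,
    isomorphic G (disjoint_union G1 G2) -> H G = H G1 * H G2.

Definition bouquet_values (H : ngraph -> {poly int}) : Prop :=
  forall (n : nat) (G : ngraph), isomorphic G (bouquet n) -> H G = n%:R *: 'X.

Definition ham_recursion (H : ngraph -> {poly int}) : Prop :=
  [/\ deletion_contraction H, multiplicative H & bouquet_values H].

(* Main.v *)
Require Import Defs.
From mathcomp Require Import all_boot all_order all_algebra.
From mathcomp Require Import zify ring.
From Stdlib Require Import FunctionalExtensionality.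

(* The polynomial is the sum of s^(components F) over the edge sets F of the
   two-regular spanning subgraphs. In the deletion-contraction rule the F
   avoiding e are counted by G - e; those containing e become two-regular in
   G/e, where the only other two-regular subgraphs are the ones meeting e at a
   single end, which are the two-factors of G - u and G - v. Uniqueness is by
   induction on the number of vertices and edges: a graph with only loops is a
   disjoint union of graphs K_1^n. *)

Set Implicit Arguments.
Unset Strict Implicit.
Unset Printing Implicit Defensive.

Import GRing.Theory.

(* [path.merge] shadows it. *)
Local Notation merge := Defs.merge.

(** * Counting connected components through maps between relations *)

Lemma homo_connect (T T' : finType) (e : rel T) (e' : rel T') (h : T -> T') :
  (forall x y, e x y -> connect e' (h x) (h y)) ->
  forall x y, connect e x y -> connect e' (h x) (h y).
Proof.
move=> he x y /connectP[p pth ->]; elim: p x pth => [|z p IHp] x //=.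
by case/andP=> /he xz /IHp; apply: connect_trans.
Qed.

(** The maps [h] and [s] preserve connectedness and are inverse to each other up to connectedness,
    so they induce inverse bijections on components. This covers contraction and vertex deletion,
    where the vertex sets differ in size. *)
Lemma n_comp_equiv (T T' : finType) (e : rel T) (e' : rel T')
    (h : T' -> T) (s : T -> T') :
  connect_sym e -> connect_sym e' ->
  (forall x y, e' x y -> connect e (h x) (h y)) ->
  (forall x y, e x y -> connect e' (s x) (s y)) ->
  (forall x, connect e x (h (s x))) -> (forall x, connect e' x (s (h x))) ->
  n_comp e predT = n_comp e' predT.
Proof.
move=> syme syme' he se hs sh.
rewrite (adjunction_n_comp h syme syme') //.
split=> [x _|x y _]; first by exists (s x).
apply/idP/idP => [|/(homo_connect se) xy]; first exact: homo_connect.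
apply: connect_trans (sh x) (connect_trans xy _).
by rewrite syme' sh.
Qed.

(** Since [a] is closed and is the image of [h], a path that starts in the image never leaves it and
    can be lifted edge by edge. It is applied to each summand of a disjoint union. *)
Lemma n_comp_embed (T T' : finType) (e : rel T) (e' : rel T')
    (h : T' -> T) (a : pred T) :
  connect_sym e -> connect_sym e' -> closed e a -> injective h ->
  (forall x, a x <-> exists y, x = h y) ->
  (forall x y, e (h x) (h y) = e' x y) ->
  n_comp e a = n_comp e' predT.
Proof.
move=> syme syme' cla injh ah eh; rewrite (adjunction_n_comp h syme syme' cla).
  by apply: eq_n_comp_r => x; rewrite !inE; apply/ah; exists x.
split=> [x ax|x y _].
  suff /sigW[y /eqP ->] : exists y, x == h y by exists y.
  by have /ah[y ->] := ax; exists y.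
apply/idP/idP.
  by apply: homo_connect => {}x {}y; rewrite -eh => /connect1.
case/connectP => p; elim: p x => [|z p IHp] x /=; first by move=> _ /injh ->.
case/andP=> exz pz lz.
have /ah[z' def_z] : a z.
  have : h x \in a by apply/ah; exists x.
  by rewrite (cla _ _ exz).
rewrite def_z in exz pz lz; apply: connect_trans (IHp _ pz lz).
by rewrite connect1 // -eh.
Qed.

Lemma inj_surj_bij (T T' : finType) (f : T -> T') :
  injective f -> (forall y, exists x, f x = y) -> bijective f.
Proof.
move=> injf surf; apply: inj_card_bij => //.
rewrite -(card_codom injf); apply/subset_leq_card/subsetP => y _.
by have [x <-] := surf y; apply: codom_f.
Qed.

(** * Degrees, two-regular edge sets and adjacency in spanning subgraphs *)

Section Incidence.

Variable G : mgraph.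
Implicit Types (e : edge G) (x : vertex G) (F : {set edge G}).

(* An edge has one or two ends, so the factor [3 - #|ends e|] is 2 for a loop
   and 1 otherwise. *)
Definition inc e x : nat := (x \in ends e) * (3 - #|ends e|).

Definition deg F x : nat := \sum_(e in F) inc e x.

Definition two_regular F : bool := [forall x, deg F x == 2].

Lemma inc_eq0 e x : (inc e x == 0) = (x \notin ends e).
Proof. by have := endsP e; rewrite /inc; case: (x \in _); lia. Qed.

Lemma deg_eq0 F x : (deg F x == 0) = [forall e in F, x \notin ends e].
Proof.
rewrite /deg sum_nat_eq0; apply: eq_forallb => e.
by rewrite inc_eq0.
Qed.

Lemma incE e x : inc e x = (x \in ends e) + (ends e == [set x]).
Proof.
rewrite /inc; case: (boolP (x \in ends e)) => [xe|xNe].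
  rewrite eq_sym eqEcard sub1set xe cards1 /=.
  by have := endsP e; lia.
by case: eqP xNe => // ->; rewrite set11.
Qed.

Lemma degree_spanning F x : @degree (spanning_subgraph F) x = deg F x.
Proof.
have sumF (P : pred (edge G)) :
    #|[set e : edge (spanning_subgraph F) | P (val e)]| = \sum_(e in F) P e.
  rewrite (big_sub (mem F)) /= cardsE -sum1_card big_mkcond /=.
  by apply: eq_bigr => e _; rewrite unfold_in; case: (P _).
rewrite /degree /= (sumF (fun e => x \in ends e)).
rewrite (sumF (fun e => ends e == [set x])) -big_split /=.
by apply: eq_bigr => e _; rewrite incE.
Qed.

Lemma is_ham_cycleE k F :
  is_ham_cycle k F =
  two_regular F && (components (spanning_subgraph F) == k).
Proof.
by congr andb; apply: eq_forallb => x; rewrite degree_spanning.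
Qed.

Lemma adjacentP F x y :
  reflect (exists2 e, e \in F & (x \in ends e) && (y \in ends e))
          (@adjacent (spanning_subgraph F) x y).
Proof.
apply: (iffP existsP) => [[e xye]|[e eF xye]]; last by exists (exist _ e eF).
by exists (val e) => //; apply: (valP e).
Qed.

Lemma adjacent_connect_sym : connect_sym (@adjacent G).
Proof.
by apply: sym_connect_sym => x y; apply: eq_existsb => e; rewrite andbC.
Qed.

End Incidence.

Lemma components_equiv (G G' : mgraph) (h : vertex G' -> vertex G)
    (s : vertex G -> vertex G') :
  (forall x y, adjacent x y -> connect (@adjacent G) (h x) (h y)) ->
  (forall x y, adjacent x y -> connect (@adjacent G') (s x) (s y)) ->
  (forall x, connect (@adjacent G) x (h (s x))) ->
  (forall x, connect (@adjacent G') x (s (h x))) ->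
  components G = components G'.
Proof. by apply: n_comp_equiv; apply: adjacent_connect_sym. Qed.

Local Open Scope ring_scope.

(** * The generating polynomial of two-regular edge sets *)

Definition hampoly (G : mgraph) : {poly int} :=
  \sum_(F : {set edge G} | two_regular F)
     'X^(components (spanning_subgraph F)).

Lemma coef_hampoly (G : mgraph) k : (hampoly G)`_k = (ham_count k G)%:Z.
Proof.
rewrite /hampoly coef_sum /ham_count -sum1_card big_set /= -natz natr_sum.
rewrite (eq_bigl _ _ (is_ham_cycleE k)) big_mkcondr /=.
by apply: eq_bigr => F _; rewrite coefXn eq_sym; case: eqP.
Qed.

Lemma two_regularP (G : mgraph) (F : {set edge G}) :
  reflect (forall x, deg F x = 2) (two_regular F).
Proof. exact: 'forall_eqP. Qed.

Lemma deg_imset (G G' : mgraph) (g : edge G' -> edge G) (F : {set edge G'}) x :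
  injective g -> deg (g @: F) x = (\sum_(e in F) inc (g e) x)%N.
Proof. by move=> injg; rewrite /deg big_imset //= => e e' _ _ /injg. Qed.

(** Edge sets of [G] are transported along an injection [g] into another edge type. With [g] the
    inclusion of the edges that survive a deletion or contraction, every polynomial in the recursion
    becomes a sum over edge sets of the original graph, and the sums can be compared term by
    term. *)
Lemma hampoly_imset (G : mgraph) (E : finType) (g : edge G -> E)
    (Q : pred {set E}) (c : {set E} -> nat) :
  injective g -> (forall F : {set edge G}, two_regular F = Q (g @: F)) ->
  (forall F : {set edge G}, two_regular F ->
     components (spanning_subgraph F) = c (g @: F)) ->
  hampoly G = \sum_(F : {set E} | (F \subset codom g) && Q F) 'X^(c F).
Proof.
move=> injg Qg cg.
have imK (F : {set edge G}) : g @^-1: (g @: F) = F.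
  by apply/setP => e; rewrite inE mem_imset.
(* Taking images under [g] is a bijection onto the subsets of [codom g], with preimage as its
   inverse. *)
rewrite (reindex_onto (fun F : {set edge G} => g @: F) (fun F => g @^-1: F)) /=.
  rewrite /hampoly; apply: eq_big => [F|F /cg -> //].
  rewrite imK eqxx andbT Qg; case: (Q _); rewrite ?andbF ?andbT //.
  by apply/esym/subsetP => _ /imsetP[e _ ->]; apply: codom_f.
move=> F /andP[/subsetP sF _]; apply/setP => y; apply/imsetP/idP.
  by case=> x; rewrite inE => ? ->.
by move=> yF; have /codomP[x yx] := sF y yF; exists x; rewrite ?inE -?yx.
Qed.

(** * Invariance under isomorphism *)

Section Isomorphism.

Variables (G G' : mgraph) (f : vertex G -> vertex G') (g : edge G -> edge G').
Hypotheses (bijf : bijective f) (bijg : bijective g).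
Hypothesis endsg : forall e, ends (g e) = f @: ends e.

Let injf := bij_inj bijf.
Let injg := bij_inj bijg.

Lemma inc_iso e x : inc (g e) (f x) = inc e x.
Proof. by rewrite /inc endsg card_imset // mem_imset. Qed.

Lemma two_regular_iso (F : {set edge G}) : two_regular F = two_regular (g @: F).
Proof.
have [f' fK f'K] := bijf.
have degf x : deg (g @: F) (f x) = deg F x.
  by rewrite deg_imset //; apply: eq_bigr => e _; rewrite inc_iso.
apply/two_regularP/two_regularP => degF x; last by rewrite -degf.
by rewrite -(f'K x) degf.
Qed.

Lemma components_iso (F : {set edge G}) :
  components (spanning_subgraph F) = components (spanning_subgraph (g @: F)).
Proof.
have [f' fK f'K] := bijf.
apply: (@components_equiv (spanning_subgraph F)
                          (spanning_subgraph (g @: F)) f' f)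
  => [x y /adjacentP[_ /imsetP[e eF ->]]|x y /adjacentP[e eF]|x|x];
  rewrite ?fK ?f'K ?connect0 //.
- rewrite -{1}(f'K x) -{1}(f'K y) endsg !mem_imset // => xy.
  by apply: connect1; apply/adjacentP; exists e.
- move=> xy; apply: connect1; apply/adjacentP.
  exists (g e); first exact: imset_f.
  by rewrite endsg !mem_imset.
Qed.

Lemma hampoly_iso : hampoly G = hampoly G'.
Proof.
rewrite (hampoly_imset (c := fun F => components (spanning_subgraph F))
  injg two_regular_iso (fun F _ => components_iso F)).
apply: eq_bigl => F; rewrite (_ : _ \subset _) //.
have [g' gK g'K] := bijg.
by apply/subsetP => e _; rewrite -(g'K e) codom_f.
Qed.

End Isomorphism.

Lemma isomorphic_sym (G G' : mgraph) : isomorphic G G' -> isomorphic G' G.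
Proof.
case=> f [g [[f' fK f'K] [g' gK g'K] fg]]; exists f', g'.
split; [by exists f | by exists g |] => e.
rewrite -{2}(g'K e) fg -imset_comp (eq_imset (g := id)) ?imset_id //.
Qed.

(** * The values on one-vertex graphs *)

Lemma hampoly_bouquet n : hampoly (bouquet n) = n%:R *: 'X.
Proof.
(* Each loop contributes 2 to the degree of the only vertex, so the two-regular sets are the [n]
   singletons. *)
have regE (F : {set 'I_n}) : @two_regular (bouquet n) F = (#|F| == 1)%N.
  have degE : @deg (bouquet n) F tt = (#|F| * 2)%N.
    rewrite /deg -sum_nat_const; apply: eq_bigr => e _.
    by rewrite /inc /= set11 cards1.
  apply/two_regularP/idP => [/(_ tt)|/eqP F1 []]; first by rewrite degE; lia.
  by rewrite degE F1.
rewrite /hampoly (eq_bigl _ _ regE) (eq_bigr (fun => 'X)) => [|F _].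
  rewrite sumr_const -cardsE card_draws card_ord bin1.
  by rewrite scaler_nat.
rewrite -['X in RHS]expr1; congr (_ ^+ _).
(* The connectedness class of [tt] has component count 1, and it is the whole vertex set. *)
rewrite -(@n_comp_connect _ _ (@adjacent_connect_sym
  (@spanning_subgraph (bouquet n) F)) tt).
by apply: eq_n_comp_r => -[]; symmetry; apply: connect0.
Qed.

(** * Multiplicativity on disjoint unions *)

Section DisjointUnion.

Variables G1 G2 : mgraph.
Let G := disjoint_union G1 G2.

Implicit Type F : {set edge G1 + edge G2}.

Let inl_inj (A B : Type) : injective (@inl A B). Proof. by move=> x y []. Qed.
Let inr_inj (A B : Type) : injective (@inr A B). Proof. by move=> x y []. Qed.

Lemma deg_inl F x : @deg G F (inl x) = deg (inl @^-1: F) x.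
Proof.
rewrite /deg big_sumType /= [X in (_ + X)%N]big1 ?addn0 => [|e _].
  apply: eq_big => [e|e _]; first by rewrite inE.
  by rewrite /inc /= card_imset ?mem_imset //; apply: inl_inj.
by apply/eqP; rewrite inc_eq0; apply/imsetP => -[].
Qed.

Lemma deg_inr F x : @deg G F (inr x) = deg (inr @^-1: F) x.
Proof.
rewrite /deg big_sumType /= [X in (X + _)%N]big1 ?add0n => [|e _].
  apply: eq_big => [e|e _]; first by rewrite inE.
  by rewrite /inc /= card_imset ?mem_imset //; apply: inr_inj.
by apply/eqP; rewrite inc_eq0; apply/imsetP => -[].
Qed.

Lemma two_regular_disjoint_union F :
  @two_regular G F = two_regular (inl @^-1: F) && two_regular (inr @^-1: F).
Proof.
apply/two_regularP/andP => [reg|[/two_regularP reg1 /two_regularP reg2] [x|x]].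
- by split; apply/two_regularP => x; rewrite -?deg_inl -?deg_inr reg.
- by rewrite deg_inl.
- by rewrite deg_inr.
Qed.

Lemma components_disjoint_union F :
  components (@spanning_subgraph G F) =
  (components (spanning_subgraph (inl @^-1: F))
   + components (spanning_subgraph (inr @^-1: F)))%N.
Proof.
(* No edge crosses between the summands, so [a], the vertices of [G1], is closed under adjacency and
   the component count splits over [a] and its complement. *)
pose a := [pred x : vertex G1 + vertex G2 | if x is inl _ then true else false].
have adjl x y : @adjacent (@spanning_subgraph G F) (inl x) (inl y) =
    @adjacent (spanning_subgraph (inl @^-1: F)) x y.
  apply/adjacentP/adjacentP => [[[e|e] eF /andP[]]|[e]].
  - rewrite !mem_imset; try exact: inl_inj.
    by move=> xe ye; exists e; rewrite ?inE ?xe.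
  - by case/imsetP.
  - rewrite inE => eF xye; exists (inl e) => //=.
    by rewrite !mem_imset //; apply: inl_inj.
have adjr x y : @adjacent (@spanning_subgraph G F) (inr x) (inr y) =
    @adjacent (spanning_subgraph (inr @^-1: F)) x y.
  apply/adjacentP/adjacentP => [[[e|e] eF /andP[]]|[e]].
  - by case/imsetP.
  - rewrite !mem_imset; try exact: inr_inj.
    by move=> xe ye; exists e; rewrite ?inE ?xe.
  - rewrite inE => eF xye; exists (inr e) => //=.
    by rewrite !mem_imset //; apply: inr_inj.
have cla : closed (@adjacent (@spanning_subgraph G F)) a.
  move=> x y /adjacentP[[e|e] _ /andP[/imsetP[x' _ ->] /imsetP[y' _ ->]]] //.
rewrite {1}/components (n_compC a); congr (_ + _)%N.
- apply: (n_comp_embed _ _ cla (@inl_inj _ _) _ adjl).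
  + exact (@adjacent_connect_sym (@spanning_subgraph G F)).
  + exact (@adjacent_connect_sym (spanning_subgraph _)).
  + by case=> x; split=> //; [exists x | case].
- apply: (n_comp_embed _ _ _ (@inr_inj _ _) _ adjr).
  + exact (@adjacent_connect_sym (@spanning_subgraph G F)).
  + exact (@adjacent_connect_sym (spanning_subgraph _)).
  + exact: (predC_closed cla).
  + by case=> x; split=> //; [case | exists x].
Qed.

Lemma hampoly_disjoint_union : hampoly G = hampoly G1 * hampoly G2.
Proof.
rewrite /hampoly big_distrlr pair_big /=.
rewrite (reindex (fun F => (inl @^-1: F, inr @^-1: F))) /=.
  apply: eq_big => F; first exact: two_regular_disjoint_union.
  by rewrite components_disjoint_union exprD.
pose join (p : {set edge G1} * {set edge G2}) : {set edge G1 + edge G2} :=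
  [set x | match x with inl e => e \in p.1 | inr e => e \in p.2 end].
apply: onW_bij; exists join => [F|[F1 F2]].
  by apply/setP => -[e|e]; rewrite !inE.
by congr pair; apply/setP => e; rewrite !inE.
Qed.

End DisjointUnion.

(** * The deletion-contraction rule *)

Section DeletionContraction.

Variables (G : mgraph) (e : edge G) (u v : vertex G).
Hypotheses (uv : u != v) (endse : ends e = [set u; v]).

Implicit Types (F : {set edge G}) (x y : vertex G).

Lemma hampoly_del_edge :
  hampoly (del_edge e) =
  \sum_(F : {set edge G} | (e \notin F) && two_regular F)
     'X^(components (spanning_subgraph F)).
Proof.
have degE (F : {set edge (del_edge e)}) x : deg (val @: F) x = deg F x.
  by rewrite (@deg_imset _ (del_edge e)) //; apply: val_inj.
rewrite (@hampoly_imset (del_edge e) _ val (@two_regular G)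
  (fun F => components (spanning_subgraph F))).
- apply: eq_bigl => F; congr (_ && _); apply/subsetP/idP => [sF|eF f fF].
    by apply/negP => /sF/codomP[[f /= fe] ef]; rewrite -ef !inE eqxx in fe.
  have fe : f \in [set~ e] by rewrite !inE; apply: contraNneq eF => <-.
  by apply/codomP; exists (exist _ f fe).
- exact: val_inj.
- by move=> F; apply: eq_forallb => x; rewrite degE.
move=> F _; apply: eq_n_comp; apply: eq_connect => x y.
apply/adjacentP/adjacentP => [[f fF xyf]|[_ /imsetP[f fF ->] xyf]].
  by exists (val f); rewrite ?imset_f.
by exists f.
Qed.

Lemma mergeP x y :
  reflect (x = y \/ x \in ends e /\ y \in ends e) (merge e x == merge e y).
Proof.
apply: (iffP eqP) => [/(congr1 val)|[-> //|[xe ye]]]; last first.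
  by apply: val_inj; rewrite /= /merge_class xe ye.
rewrite /= /merge_class; case: ifP => xe; case: ifP => ye.
- by right.
- by move=> E; rewrite E set11 in ye.
- by move=> E; rewrite -E set11 in xe.
- by move/set1_inj; left.
Qed.

Lemma merge_surj (w : merged e) : exists x, w = merge e x.
Proof.
case: w => A Ap; have /codomP[x Ax] := Ap.
by exists x; apply: val_inj.
Qed.

(** An edge parallel to [e] becomes a loop at the merged vertex, of weight 2 = 1 + 1. For any other
    edge [merge e] is injective on its ends, so its weight is kept, and at most one of [u] and [v]
    is among its ends. *)
Lemma inc_contract (f : edge (contract e)) x :
  inc f (merge e x) =
  if x \in ends e then (inc (val f) u + inc (val f) v)%N else inc (val f) x.
Proof.
case: f => f fe; rewrite /inc /=.
have /andP[_ f2] := endsP f.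
have [/andP[uf vf]|uvf] := boolP ((u \in ends f) && (v \in ends f)).
  have ends_f : ends f = [set u; v].
    apply/esym/eqP; rewrite eqEcard cards2 uv f2 andbT.
    by apply/subsetP => z; rewrite !inE => /orP[] /eqP ->.
  have im_f : [set merge e x | x in ends f] = [set merge e u].
    apply/setP => w; rewrite inE; apply/imsetP/eqP => [[z zf ->]|->].
      apply/eqP/mergeP; right.
      by rewrite endse -ends_f zf uf.
    by exists u.
  rewrite im_f cards1 inE uf vf ends_f cards2 uv.
  have -> : (merge e x == merge e u) = (x \in ends e).
    apply/mergeP/idP => [[->|[]//]|xe]; first by rewrite endse set21.
    by right; rewrite xe endse set21.
  by rewrite -endse; case: (x \in ends e).
have injm : {in ends f &, injective (merge e)}.
  move=> y z yf zf /eqP/mergeP[//|[]]; rewrite endse !inE.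
  by case/orP=> /eqP ye /orP[] /eqP ze; subst y z => //; rewrite yf zf in uvf.
rewrite card_in_imset //.
have -> : (merge e x \in [set merge e x | x in ends f]) =
   if x \in ends e then (u \in ends f) || (v \in ends f) else x \in ends f.
  apply/imsetP/idP => [[y yf /eqP/mergeP[->|[-> ye]]]|].
  - case: ifP => //; rewrite endse !inE => /orP[] /eqP E;
      by rewrite -E yf ?orbT.
  - by move: ye; rewrite endse !inE => /orP[] /eqP <-; rewrite yf ?orbT.
  case: ifP => [xe /orP[wf|wf]|_ xf]; last by exists x.
  - exists u => //; apply/eqP/mergeP; right.
    by rewrite xe endse set21.
  - exists v => //; apply/eqP/mergeP; right.
    by rewrite xe endse set22.
case: ifP => // _; move: uvf.
by case: (u \in _); case: (v \in _) => //= _; rewrite ?mul0n ?mul1n ?addn0.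
Qed.

(* The edge sets F avoiding e for which F / e is two-regular in G / e. *)
Definition contracted_regular F : bool :=
  (deg F u + deg F v == 2)%N && [forall (x | x \notin ends e), deg F x == 2].

(** The exponent shared by the sums for G/e, G-u and G-v: putting [e] back places [u] and [v] in one
    component. *)
Let joined F : nat := components (spanning_subgraph (e |: F)).

Lemma connect_e F x y : x \in ends e -> y \in ends e ->
  connect (@adjacent (spanning_subgraph (e |: F))) x y.
Proof.
move=> xe ye; apply: connect1; apply/adjacentP.
by exists e; rewrite ?setU11 ?xe.
Qed.

Lemma components_contract (F : {set edge (contract e)}) :
  components (spanning_subgraph F) = joined (val @: F).
Proof.
(* [s] picks a representative of each class; it can differ from the original vertex only within the
   ends of [e], which [e] itself connects. *)
pose s (w : merged e) : vertex G := iinv (valP w).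
have sK w : merge e (s w) = w by apply: val_inj; exact: (f_iinv (valP w)).
have connect_s x : connect (@adjacent (spanning_subgraph (e |: val @: F)))
    x (s (merge e x)).
  have /eqP/mergeP[->|[] //] := sK (merge e x); first exact: connect0.
  by move=> ? ?; apply: connect_e.
pose Ge := spanning_subgraph (e |: val @: F).
apply: (@components_equiv (spanning_subgraph F) Ge (merge e) s).
- move=> x y /adjacentP[f + /andP[xf yf]].
  case/setU1P => [fe|/imsetP[f' f'F def_f]].
    rewrite fe in xf yf.
    have /eqP -> : merge e x == merge e y by apply/mergeP; right.
    exact: connect0.
  apply: connect1; apply/adjacentP; exists f' => //=.
  by rewrite -def_f !imset_f.
- move=> w1 w2 /adjacentP[f fF /andP[/imsetP[x xf ->] /imsetP[y yf ->]]].
  apply: connect_trans (connect_s y).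
  rewrite adjacent_connect_sym; apply: connect_trans (connect_s x).
  apply: connect1; apply/adjacentP; exists (val f); rewrite ?xf ?yf //.
  by apply/setU1P; right; apply: imset_f.
- by move=> w; rewrite sK connect0.
- exact: connect_s.
Qed.

Lemma hampoly_contract :
  hampoly (contract e) =
  \sum_(F : {set edge G} | (e \notin F) && contracted_regular F) 'X^(joined F).
Proof.
have degE (F : {set edge (contract e)}) x : deg F (merge e x) =
    if x \in ends e then (deg (val @: F) u + deg (val @: F) v)%N
    else deg (val @: F) x.
  rewrite !(@deg_imset _ (contract e)); try exact: val_inj.
  rewrite /deg (eq_bigr _ (fun f _ => inc_contract f x)).
  by case: ifP => // _; rewrite big_split.
rewrite (@hampoly_imset (contract e) _ val contracted_regular joined).
- apply: eq_bigl => F; congr (_ && _); apply/subsetP/idP => [sF|eF f fF].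
    by apply/negP => /sF/codomP[[f /= fe] ef]; rewrite -ef eqxx in fe.
  have fe : f != e by apply: contraNneq eF => <-.
  by apply/codomP; exists (exist _ f fe).
- exact: val_inj.
- move=> F; apply/two_regularP/andP => [reg|[/eqP reguv /forall_inP reg] w].
    split; first by have := reg (merge e u); rewrite degE endse set21 => ->.
    apply/forall_inP => x xe.
    by have := reg (merge e x); rewrite degE (negPf xe) => ->.
  have [x ->] := merge_surj w; rewrite degE; case: ifP => // /negbT xe.
  by apply/eqP/reg.
- by move=> F _; apply: components_contract.
Qed.

Section DelVertex.

Variables w w' : vertex G.
Hypotheses (ww' : w' != w) (endsw : ends e = [set w; w']).

Lemma inc_del_vertex (f : edge (del_vertex w)) (x : vertex (del_vertex w)) :
  inc f x = inc (val f) (val x).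
Proof.
rewrite /inc /= inE; congr (_ * (3 - _))%N.
case: f => f /= wf.
rewrite -(card_imset _ val_inj); apply: eq_card => y.
apply/imsetP/idP => [[z]|yf]; first by rewrite inE => ? ->.
have yw : y != w by apply: contraNneq wf => <-.
by exists (exist _ y yw); rewrite ?inE.
Qed.

(** No edge of [F] meets [w], so adding [e] attaches [w] to [w'] as a pendant vertex and the number
    of components does not change. *)
Lemma components_del_vertex (F : {set edge (del_vertex w)}) :
  components (spanning_subgraph F) = joined (val @: F).
Proof.
pose z : vertex (del_vertex w) := exist _ w' ww'.
(* The default value [z] of [insubd] matters: it retracts the deleted vertex [w] onto its neighbour
   [w']. *)
pose s (x : vertex G) : vertex (del_vertex w) := insubd z x.
have sK (x : vertex (del_vertex w)) : s (val x) = x by apply: valKd.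
have valsE x : x != w -> val (s x) = x by move=> xw; apply: insubdK.
have sw : s w = z by rewrite /s /insubd insubF // eqxx.
have [we w'e] : w \in ends e /\ w' \in ends e by rewrite endsw set21 set22.
pose Ge := spanning_subgraph (e |: val @: F).
have sz x : x \in ends e -> s x = z.
  by rewrite endsw => /set2P[] ->; rewrite // -[w']/(val z) sK.
apply: (@components_equiv (spanning_subgraph F) Ge s val).
- move=> x y /adjacentP[f + /andP[xf yf]].
  case/setU1P => [fe|/imsetP[f' f'F def_f]].
    by rewrite fe in xf yf; rewrite !sz ?connect0.
  have wf : w \notin ends f by rewrite def_f (valP f').
  apply: connect1; apply/adjacentP; exists f' => //=.
  rewrite !inE !valsE -?def_f ?xf //.
    by apply: contraNneq wf => <-.
  by apply: contraNneq wf => <-.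
- move=> x y /adjacentP[f fF]; rewrite /= !inE => xyf.
  apply: connect1; apply/adjacentP; exists (val f) => //.
  by apply/setU1P; right; apply: imset_f.
- by move=> x; rewrite sK connect0.
- move=> x; have [->|xw] := eqVneq x w; last by rewrite valsE ?connect0.
  by rewrite sw; apply: connect_e.
Qed.

(** Degree 0 at [w] says that [F] consists of edges of G-w. The degree conditions at [w'] and away
    from [e] are listed separately to match [contracted_regular]. Stated for [w] and [w'] so that it
    serves both ends of [e]. *)
Lemma hampoly_del_vertex :
  hampoly (del_vertex w) =
  \sum_(F : {set edge G} | [&& e \notin F, deg F w == 0%N, deg F w' == 2
         & [forall (x | x \notin ends e), deg F x == 2]]) 'X^(joined F).
Proof.
have degE (F : {set edge (del_vertex w)}) (x : vertex (del_vertex w)) :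
    deg (val @: F) (val x) = deg F x.
  rewrite (@deg_imset _ (del_vertex w)); last exact: val_inj.
  by apply: eq_bigr => f _; rewrite inc_del_vertex.
pose Q F := [forall (x | x != w), deg F x == 2].
rewrite (@hampoly_imset (del_vertex w) _ val Q joined).
- apply: eq_bigl => F; rewrite deg_eq0.
  have -> : (F \subset codom (val : edge (del_vertex w) -> edge G)) =
      [forall f in F, w \notin ends f].
    apply/subsetP/forall_inP => [sF f /sF/codomP[f' ->]|Fw f fF].
      exact: (valP f').
    by apply/codomP; exists (exist _ f (Fw f fF)).
  have [/forall_inP Fw|_] := boolP [forall f in F, w \notin ends f];
    last by rewrite andbF.
  have -> /= : e \notin F by apply/negP => /Fw; rewrite endsw set21.
  apply/forall_inP/andP => [reg|[w'2 /forall_inP reg] x xw].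
    split; first exact: reg.
    apply/forall_inP => x; rewrite endsw !inE negb_or => /andP[xw _].
    exact: reg.
  have [-> //|xw'] := eqVneq x w'.
  by apply: reg; rewrite endsw !inE negb_or xw.
- exact: val_inj.
- move=> F; apply/two_regularP/forall_inP => [reg x xw|reg x].
    by rewrite -(reg (exist _ x xw)) -degE.
  by rewrite -degE; apply/eqP/reg/(valP x).
- by move=> F _; apply: components_del_vertex.
Qed.

End DelVertex.

(** Since [e] is not a loop, adding it raises the degree by exactly one at [u] and at [v], and
    nowhere else. *)
Lemma two_regular_setU1 F : e \notin F ->
  two_regular (e |: F) =
  [&& deg F u == 1, deg F v == 1
    & [forall (x | x \notin ends e), deg F x == 2]]%N.
Proof.
move=> eF; have degE x : deg (e |: F) x = ((x \in ends e) + deg F x)%N.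
  by rewrite /deg big_setU1 //= {1}/inc endse cards2 uv muln1.
have [ue ve] : u \in ends e /\ v \in ends e by rewrite endse set21 set22.
apply/two_regularP/and3P => [reg|[/eqP u1 /eqP v1 /forall_inP reg] x].
  split; last apply/forall_inP => x xe.
  - by have := reg u; rewrite degE ue; lia.
  - by have := reg v; rewrite degE ve; lia.
  - by have := reg x; rewrite degE (negPf xe) add0n => ->.
rewrite degE; have [|xe] := boolP (x \in ends e); last by apply/eqP/reg.
by rewrite endse => /set2P[] ->; rewrite ?u1 ?v1.
Qed.

(* Contracting e, the two edge ends that F has at the new vertex come from one
   at u and one at v (then F + e is a two-factor of G), or both from u (then F
   is a two-factor of G - v), or both from v. *)
Lemma hampoly_deletion_contraction :
  hampoly G = hampoly (del_edge e) + hampoly (contract e)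
              - hampoly (del_vertex u) - hampoly (del_vertex v).
Proof.
have vu : v != u by rewrite eq_sym.
have endse' : ends e = [set v; u] by rewrite endse setUC.
(* Removing [e] is a bijection from the two-factors through [e]. What remains has degree 1 at both
   [u] and [v], that is, degree sum 2 with neither degree zero. *)
have withe : \sum_(F : {set edge G} | two_regular F && ~~ (e \notin F))
      'X^(components (spanning_subgraph F)) =
    \sum_(F : {set edge G} | [&& e \notin F, contracted_regular F,
       deg F u != 0 & deg F v != 0]%N) 'X^(joined F) :> {poly int}.
  rewrite (reindex_onto (fun F => e |: F) (fun F => F :\ e)) /=; last first.
    by move=> F /andP[_ /negPn eF]; rewrite setD1K.
  apply: eq_bigl => F; rewrite setU11 andbT.
  have [eF|eF] /= := boolP (e \in F).
    have /negPf -> : (e |: F) :\ e != F.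
      by apply: contraTneq eF => <-; rewrite setD11.
    by rewrite andbF.
  rewrite setU1K // eqxx andbT two_regular_setU1 // /contracted_regular.
  by case: [forall (x | _), _]; rewrite ?andbF ?andbT //=; lia.
(* Degree sum 2 with degree 0 at [a] forces degree 2 at the other end [b]. *)
have delv (a b : vertex G) : (a == u) && (b == v) || (a == v) && (b == u) ->
    hampoly (del_vertex a) = \sum_(F : {set edge G} |
      [&& e \notin F, contracted_regular F & deg F a == 0]%N) 'X^(joined F).
  move=> ab; rewrite (@hampoly_del_vertex a b); last 2 first.
  - by case/orP: ab => /andP[/eqP -> /eqP ->].
  - by case/orP: ab => /andP[/eqP -> /eqP ->].
  apply: eq_bigl => F; congr (_ && _); rewrite /contracted_regular.
  case: [forall (x | _), _]; rewrite ?andbF ?andbT //=.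
  by case/orP: ab => /andP[/eqP -> /eqP ->]; lia.
rewrite hampoly_del_edge hampoly_contract.
rewrite (delv u v) ?(delv v u) ?eqxx ?orbT //.
rewrite {1}/hampoly (bigID (fun F : {set edge G} => e \notin F)) /= withe.
under eq_bigl => F do rewrite andbC.
rewrite -!addrA; congr (_ + _).
(* The sum for G/e splits into three: degree 0 at [u], then degree 0 at [v] among the rest, then
   both degrees nonzero. The first two cancel the vertex deletions and the third is the sum over
   two-factors through [e]. *)
rewrite [in RHS](bigID (fun F : {set edge G} => deg F u == 0%N)) /=.
rewrite [X in _ + X + _](bigID (fun F : {set edge G} => deg F v == 0%N)) /=.
set S := \sum_(F | _) _; set Su := \sum_(F | _) _.
set Sv := \sum_(F | _) _; set S' := \sum_(F | _) _.
set Tu := \sum_(F | _) _; set Tv := \sum_(F | _) _.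
have -> : Su = Tu by apply: eq_bigl => F; rewrite andbA.
have -> : S' = S by apply: eq_bigl => F; rewrite !andbA.
(* [Sv] also asks for a nonzero degree at [u], which follows from degree sum 2 and degree 0 at
   [v]. *)
have -> : Sv = Tv.
  apply: eq_bigl => F; rewrite /contracted_regular.
  case: (e \notin F); case: [forall (x | _), _]; rewrite ?andbF ?andbT //=.
  lia.
by ring.
Qed.

End DeletionContraction.

(** * Graphs whose edges are all loops *)

Lemma isomorphic_bouquet (G : mgraph) :
  #|vertex G| = 1%N -> isomorphic G (bouquet #|edge G|).
Proof.
move=> G1; have /fintype1P[x0 allx0] : #|vertex G| == 1%N by apply/eqP.
exists (fun => tt), enum_rank; split.
- by exists (fun => x0) => [x|[]] //; rewrite [RHS]allx0.
- exact: enum_rank_bij.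
- move=> e; have /andP[/card_gt0P[x xe] _] := endsP e.
  by apply/setP => -[]; rewrite set11; apply/esym/imsetP; exists x.
Qed.

Section LoopsOnly.

Variables (G : mgraph) (u : vertex G).
Hypothesis loops : forall e : edge G, #|ends e| = 1%N.

Lemma vertex_loops_endsP (e : {e : edge G | u \in ends e}) :
  (0 < #|[set tt]| <= 2)%N.
Proof. by rewrite cards1. Qed.

(** A bouquet indexed by the edges at [u] themselves, so that the isomorphism below is a plain
    projection; [isomorphic_bouquet] turns it into some K_1^n. *)
Definition vertex_loops : mgraph := MGraph vertex_loops_endsP.

(** When all edges are loops, no edge joins [u] to another vertex, so deleting [u] loses only the
    loops at [u]. *)
Lemma isomorphic_vertex_loops :
  isomorphic G (disjoint_union vertex_loops (del_vertex u)).
Proof.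
apply: isomorphic_sym.
pose f (x : unit + {x : vertex G | x != u}) :=
  if x is inr x' then val x' else u.
pose g (x : {e : edge G | u \in ends e} + {e : edge G | u \notin ends e}) :=
  match x with inl e => val e | inr e => val e end.
exists f, g; split.
- apply: inj_surj_bij => [[[]|[x xu]] [[]|[y yu]] //=|x].
  + by move=> uy; exfalso; rewrite -uy eqxx in yu.
  + by move=> xu'; exfalso; rewrite xu' eqxx in xu.
  + by move=> xy; congr inr; apply: val_inj.
  + have [->|xu] := eqVneq x u; first by exists (inl tt).
    by exists (inr (exist _ x xu)).
- apply: inj_surj_bij => [[[d du]|[d du]] [[e eu]|[e eu]] //= de|e].
  + by congr inl; apply: val_inj.
  + by exfalso; rewrite de (negPf eu) in du.
  + by exfalso; rewrite de eu in du.
  + by congr inr; apply: val_inj.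
  + have [eu|eu] := boolP (u \in ends e).
      by exists (inl (exist _ e eu)).
    by exists (inr (exist _ e eu)).
case=> [[e eu]|[e eu]] /=.
  have /eqP/cards1P[x ex] := loops e; rewrite ex inE in eu *.
  by rewrite !imset_set1 /= (eqP eu).
apply/setP => x; apply/idP/imsetP => [xe|[_ /imsetP[y ye ->] ->]].
  have xu : x != u by apply: contraNneq eu => <-.
  by exists (inr (exist _ x xu)) => //; apply: imset_f; rewrite inE.
by rewrite inE in ye.
Qed.

End LoopsOnly.

(** * Uniqueness by induction on size, and the theorem *)

Lemma card_contract (G : mgraph) (e : edge G) (u v : vertex G) :
  u != v -> ends e = [set u; v] -> (#|vertex (contract e)| < #|vertex G|)%N.
Proof.
move=> uv endse; rewrite card_sig.
rewrite ltn_neqAle leq_image_card andbT; apply/negP => /image_injP inj.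
case/eqP: uv; apply: inj => //.
by rewrite /merge_class endse set21 set22.
Qed.

Lemma card_del_vertex (G : mgraph) (u : vertex G) :
  #|vertex G| = #|vertex (del_vertex u)|.+1.
Proof.
have -> : #|vertex (del_vertex u)| = #|predC1 u|.
  by rewrite card_sig; apply: eq_card.
rewrite cardC1 prednK //.
by apply/card_gt0P; exists u.
Qed.

Lemma ham_recursion_unique (H H' : ngraph -> {poly int}) :
  ham_recursion H -> ham_recursion H' -> H =1 H'.
Proof.
move=> [dcH mulH bouH] [dcH' mulH' bouH'] G.
have [n] := ubnP (#|vertex G| + #|edge G|)%N; elim: n G => // n IHn G leGn.
have IHsize (K : ngraph) :
    (#|vertex K| + #|edge K| < #|vertex G| + #|edge G|)%N -> H K = H' K.
  by move=> ltKG; apply: IHn; apply: leq_trans ltKG _.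
have [/existsP[e /cards2P[u [v [uv endse]]]]|noedge] :=
  boolP [exists e : edge G, #|ends e| == 2].
  have vu : v != u by rewrite eq_sym.
  rewrite (dcH G e u v vu uv endse) (dcH' G e u v vu uv endse).
  (* G-e has one edge less; the other three graphs have fewer vertices and no more edges. *)
  congr (_ + _ - _ - _); apply: IHsize.
  - rewrite -addnS leq_add // card_sig (eq_card (B := predC1 e)) => [|f].
      by rewrite cardC1 prednK //; apply/card_gt0P; exists e.
    by rewrite !inE.
  - by rewrite -addSn leq_add ?(card_contract uv endse) // card_sig max_card.
  - by rewrite -addSn leq_add ?(card_del_vertex u) // card_sig max_card.
  - by rewrite -addSn leq_add ?(card_del_vertex v) // card_sig max_card.
have loops (e : edge G) : #|ends e| = 1%N.
  have := endsP e; move: noedge; rewrite negb_exists => /forallP/(_ e); lia.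
have [u _] := card_gt0P (ngraphP G).
(* The one-vertex case is separate because multiplicativity needs G-u to be nonempty. *)
have [G1|Gn1] := eqVneq #|vertex G| 1%N.
  have isoG := isomorphic_bouquet G1.
  by rewrite (bouH _ _ isoG) (bouH' _ _ isoG).
have cardu := card_del_vertex u.
have L0 : (0 < #|vertex (vertex_loops u)|)%N by rewrite card_unit.
have D0 : (0 < #|vertex (del_vertex u)|)%N by have := ngraphP G; lia.
have iso : isomorphic G (disjoint_union (NGraph L0) (NGraph D0)).
  exact: isomorphic_vertex_loops.
rewrite (mulH _ _ _ iso) (mulH' _ _ _ iso); congr (_ * _).
  have isoL : isomorphic (NGraph L0) (bouquet #|edge (vertex_loops u)|).
    by apply: isomorphic_bouquet; rewrite card_unit.
  by rewrite (bouH _ _ isoL) (bouH' _ _ isoL).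
apply: IHsize.
by rewrite -addSn leq_add ?(card_del_vertex u) // card_sig max_card.
Qed.

Theorem theorem2 :
  exists H : ngraph -> {poly int},
    unique ham_recursion H /\
    (forall (G : ngraph) (k : nat), (H G)`_k = (ham_count k G)%:Z).
Proof.
exists hampoly; split; last by move=> G k; apply: coef_hampoly.
have rec_hampoly : ham_recursion hampoly.
  split=> [G e u v vu uv endse|G G1 G2|n G].
  - exact: hampoly_deletion_contraction.
  - case=> f [g [bijf bijg fg]].
    by rewrite (hampoly_iso bijf bijg fg) hampoly_disjoint_union.
  - case=> f [g [bijf bijg fg]].
    by rewrite (hampoly_iso bijf bijg fg) hampoly_bouquet.
(* Uniqueness is stated as equality of functions, so pointwise agreement is lifted by
   extensionality. *)
split=> // H' recH'; apply: functional_extensionality => G.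
exact: (ham_recursion_unique rec_hampoly recH').
Qed.
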